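(* Let $(\mathcal{S},X,\Phi)$ be a dynamical system that is almost open, topologically transitive and non-minimal (i.e. not minimal). If the set $\mathcal{M}^{-1}=\bigcup_{s\in\mathcal{S}}\Phi_s^{-1}(\mathcal{M})$ is dense in $X$, then $(\mathcal{S},X,\Phi)$ is sensitive.
   Context: A dynamical system is a triplet $(\mathcal{S},X,\Phi)$ where $\mathcal{S}$ is a topological semigroup, $X$ is a metric space with metric $d$, and $\Phi:\mathcal{S}\times X\to X$ is a continuous function with $\Phi(s_1,\Phi(s_2,x))=\Phi(s_1s_2,x)$ for all $s_1,s_2\in\mathcal{S}$ and all $x\in X$. Write $\Phi_s(x)=\Phi(s,x)$. The orbit of $x\in X$ is $O(x)=\{\Phi_s(x): s\in\mathcal{S}\}$. A non-empty set $Y\subset X$ is minimal if $\overline{O(y)}=Y$ for every $y\in Y$. A point $x\in X$ is minimal if $\overline{O(x)}$ is compact and is a minimal set. $\mathcal{M}$ denotes the set of minimal points. The system is minimal if there exists a minimal point $x\in X$ with $\overline{O(x)}=X$. The system is topologically transitive if for all non-empty open sets $U,V\subset X$ there exists $s\in\mathcal{S}$ with $\Phi_s(U)\cap V\neq\emptyset$. The map $\Phi_s$ is almost open if $\Phi_s(U)$ has non-empty interior for every non-empty open set $U\subset X$; the system is almost open if $\Phi_s$ is almost open for every $s\in\mathcal{S}$. The system is sensitive if there exists $\varepsilon>0$ such that for all $x\in X$ and all $\delta>0$ there exist $y\in B(x,\delta)$ (the ball of center $x$ and radius $\delta$) and $s\in\mathcal{S}$ such that $d(\Phi_s(x),\Phi_s(y))>\varepsilon$.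 *)

(* Defs.v *)
From HB Require Import structures.
From mathcomp Require Import all_boot all_order all_algebra.
From mathcomp Require Import all_classical all_reals all_analysis.

Set Implicit Arguments.
Unset Strict Implicit.
Unset Printing Implicit Defensive.

Local Open Scope classical_set_scope.
Local Open Scope ring_scope.

HB.mixin Record isTopologicalSemigroup S & Topological S & Semigroup S := {
  mulg_continuous : continuous (fun p : S * S => (p.1 * p.2)%g)
}.

(* No separation axiom and no identity element are assumed. *)
#[short(type="topologicalSemigroupType")]
HB.structure Definition TopologicalSemigroup :=
  {S of Topological S & Semigroup S & isTopologicalSemigroup S}.

Record dynamical_system (R : realType) (S : topologicalSemigroupType)
    (X : metricType R) := DynamicalSystem {
  action :> S -> X -> X ;
  action_continuous : continuous (fun p : S * X => action p.1 p.2) ;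
  actionM : forall (s1 s2 : S) (x : X),
    action s1 (action s2 x) = action (s1 * s2)%g x
}.

Section dynamics.
Context (R : realType) (S : topologicalSemigroupType) (X : metricType R).
Variable Phi : dynamical_system S X.

(* S need not have an identity, so x need not belong to its own orbit. *)
Definition sys_orbit (x : X) : set X := range (fun s : S => Phi s x).

Definition minimal_set (Y : set X) : Prop :=
  Y !=set0 /\ forall y, Y y -> closure (sys_orbit y) = Y.

Definition minimal_point (x : X) : Prop :=
  compact (closure (sys_orbit x)) /\ minimal_set (closure (sys_orbit x)).

Definition minimal_points : set X := [set x | minimal_point x].

Definition minimal_system : Prop :=
  exists x, minimal_point x /\ closure (sys_orbit x) = setT.

Definition topologically_transitive : Prop :=
  forall U V : set X, open U -> U !=set0 -> open V -> V !=set0 ->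
    exists s : S, (Phi s @` U) `&` V !=set0.

Definition almost_open_map (f : X -> X) : Prop :=
  forall U : set X, open U -> U !=set0 -> (f @` U)° !=set0.

Definition almost_open_system : Prop := forall s : S, almost_open_map (Phi s).

Definition sensitive : Prop :=
  exists2 eps : R, 0 < eps &
    forall (x : X) (delta : R), 0 < delta ->
      exists y : X, exists s : S,
        ball x delta y /\ eps < mdist (Phi s x) (Phi s y).

Definition minimal_preimages : set X :=
  \bigcup_(s : S) (Phi s @^-1` minimal_points).

End dynamics.

(* Main.v *)
Require Import Defs.
From mathcomp Require Import all_boot all_order all_algebra.
From mathcomp Require Import all_classical all_reals all_analysis.
From mathcomp Require Import finmap lra.

Import Order.TTheory GRing.Theory Num.Theory.
Local Open Scope classical_set_scope.
Local Open Scope ring_scope.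

(** Let [K] be the orbit closure of a minimal point; as the system is not
    minimal, some [ball w (6 e)] misses [K].  If the system is not sensitive,
    all iterates of some ball [U] have radius at most [e].  Pick [y] in [U] and
    [s0] such that [m = s0 y] is minimal.  Almost openness yields a non-empty
    open set [W] inside [s0 U], every point of which shadows [m] within [2 e]
    along all of the semigroup.  By transitivity some point of [W] visits
    [ball w e], so [m] visits [ball w (3 e)], and it does so syndetically: there
    is a finite [F] such that every [t] admits [s] in [F] with [s t m] in
    [ball w (3 e)].  Transitivity again moves some [z] in [W] by some [t] so
    close to a point [k] of [K] that [s t z] is within [e] of [s k], a point of
    [K], for all [s] in [F].  Then [s k] is in [ball w (6 e)] for the [s] given
    by [t], a contradiction. *)

Lemma metric_ball_open (R : realFieldType) (X : metricType R) (x : X) (r : R) :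
  open (ball x r).
Proof.
rewrite openE => y; rewrite ballEmdist /= => xyr.
apply/nbhs_ballP; exists (r - mdist x y); first by rewrite /= subr_gt0.
move=> z; rewrite !ballEmdist /= => yz.
by have := metric_triangle x y z; lra.
Qed.

Section dynamics.
Set Implicit Arguments.
Unset Strict Implicit.
Context (R : realType) (S : topologicalSemigroupType) (X : metricType R).
Variable Phi : dynamical_system S X.

Lemma action_continuousr (s : S) : continuous (Phi s).
Proof.
move=> x; have /= := @action_continuous _ _ _ Phi (s, x).
apply: (@continuous_comp _ _ _ (fun y : X => (s, y))).
by apply: cvg_pair; [exact: cvg_cst|exact: cvg_id].
Qed.

Lemma orbit_closure_action (s : S) (x : X) : closure (sys_orbit Phi x) (Phi s x).
Proof. by apply: subset_closure; exists s. Qed.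

Lemma minimal_set_action (Y : set X) (s : S) (y : X) :
  minimal_set Phi Y -> Y y -> Y (Phi s y).
Proof. by move=> [_ Ymin] /Ymin <-; exact: orbit_closure_action. Qed.

Lemma minimal_set_visits (Y V : set X) (y : X) :
  minimal_set Phi Y -> open V -> Y `&` V !=set0 -> Y y ->
  exists s, V (Phi s y).
Proof.
move=> [_ Ymin] oV [v [Yv Vv]] Yy; move: Yv; rewrite -(Ymin _ Yy).
move=> /(_ V (open_nbhs_nbhs (conj oV Vv))) [_ [[s _ <-]] Vsy].
by exists s.
Qed.

(** By minimality the open preimages of [V] under the maps [Phi s] cover [Y], and compactness leaves
    finitely many of them. *)
Lemma compact_minimal_set_syndetic (Y V : set X) :
  compact Y -> minimal_set Phi Y -> open V -> Y `&` V !=set0 ->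
  exists F : {fset S}, forall y, Y y -> exists2 s, s \in F & V (Phi s y).
Proof.
move=> /compact_near_coveringP cY Ymin oV YV.
pose visits (F : {fset S}) y := exists2 s, s \in F & V (Phi s y).
(* Eventually along this filter means for all finite sets containing a fixed one, so near-covering
   compactness merges the local choices of [s] into one [F]. *)
pose supersets := filter_from setT (fun A => [set F : {fset S} | A `<=` F]%fset).
have supersets_filter : Filter supersets.
  apply: filter_from_filter; first by exists fset0.
  move=> A B _ _; exists (A `|` B)%fset => // F /=.
  by rewrite fsubUset => /andP.
have [y Yy|F _ FY] := cY _ supersets visits supersets_filter.
  have [s Vsy] := minimal_set_visits Ymin oV YV Yy.
  exists (Phi s @^-1` V, [set F | s \in F]); last first.
    by move=> [y' F] [/= Vsy' sF]; exists s.
  split=> /=.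
    by apply: action_continuousr; exact: open_nbhs_nbhs.
  by exists [fset s]%fset => // F /= /fsubsetP; apply; rewrite inE.
by exists F; apply: FY => /=; exact: fsubset_refl.
Qed.

Definition uniformly_stable_ball (x : X) (delta e : R) : Prop :=
  forall (y : X) (s : S), ball x delta y -> mdist (Phi s x) (Phi s y) <= e.

Lemma not_sensitive_stable_ball (e : R) : 0 < e -> ~ sensitive Phi ->
  exists x delta, 0 < delta /\ uniformly_stable_ball x delta e.
Proof.
move=> e0 nsens; apply: contrapT => nstable; apply: nsens; exists e => // x d d0.
apply: contrapT => nys; apply: nstable; exists x, d; split=> // y s xy.
by rewrite leNgt; apply/negP => exy; apply: nys; exists y, s.
Qed.

(** On the image of a stable ball under [Phi s0], [s] acts as [s * s0] does on the ball; the bound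
    doubles since [m] and [z] are compared through the orbit of the centre. *)
Lemma not_sensitive_shadowing (e : R) : almost_open_system Phi ->
  dense (minimal_preimages Phi) -> ~ sensitive Phi -> 0 < e ->
  exists (m : X) (W : set X),
    [/\ minimal_point Phi m, open W, W !=set0 &
      forall z s, W z -> mdist (Phi s m) (Phi s z) <= 2 * e].
Proof.
move=> aopen mdense nsens e0.
have [x [d [d0 stable]]] := not_sensitive_stable_ball e0 nsens.
have oU := metric_ball_open R X x d.
have U0 : ball x d !=set0 by exists x; exact: ballxx.
have [y [Uy [s0 _ min_s0y]]] := mdense _ U0 oU.
exists (Phi s0 y), (Phi s0 @` ball x d)°; split => //.
- exact: open_interior.
- exact: aopen.
move=> _ s /interior_subset[u Uu <-].
rewrite !actionM; have := metric_triangle (Phi (s * s0)%g y) (Phi (s * s0)%g x)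
  (Phi (s * s0)%g u).
rewrite (metric_sym (Phi (s * s0)%g y) (Phi (s * s0)%g x)).
have := stable _ (s * s0)%g Uy; have := stable _ (s * s0)%g Uu; lra.
Qed.

Lemma transitive_near_action (W : set X) (k : X) (F : {fset S}) (e : R) :
  topologically_transitive Phi -> open W -> W !=set0 -> 0 < e ->
  exists z t, W z /\ forall s, s \in F -> mdist (Phi s k) (Phi s (Phi t z)) < e.
Proof.
move=> trans oW W0 e0.
(* Finiteness of [F] makes [N] a neighbourhood of [k]. *)
pose N := \bigcap_(s in [set` F]) (Phi s @^-1` ball (Phi s k) e).
have Nk : nbhs k N.
  apply: filter_bigI => s _; apply: action_continuousr.
  exact: nbhsx_ballx.
have [] := trans W N° oW W0 (open_interior N); first by exists k.
move=> t [_ [[z Wz <-] /interior_subset Ntz]].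
by exists z, t; split=> // s sF; have := Ntz s sF; rewrite /= ballEmdist.
Qed.

End dynamics.

Theorem theorem1p2 (R : realType) (S : topologicalSemigroupType)
    (X : metricType R) (Phi : dynamical_system S X) :
  almost_open_system Phi ->
  topologically_transitive Phi ->
  ~ minimal_system Phi ->
  dense (minimal_preimages Phi) ->
  sensitive Phi.
Proof.
move=> aopen trans nmin mdense; apply: contrapT => nsens.
(* The value [1] is arbitrary: only the minimal point is kept. *)
have [p pmin] : exists p, minimal_point Phi p.
  have [m [_ [mmin _ _ _]]] :=
    not_sensitive_shadowing aopen mdense nsens (@ltr01 R).
  by exists m.
set K := closure (sys_orbit Phi p).
have [[k Kk] _] : minimal_set Phi K by case: pmin.
have [w Kw] : exists w, ~ K w.
  apply/existsNP => KT; apply: nmin; exists p; split=> //.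
  by rewrite -subTset => y _; exact: KT.
have [r /= r0 wrK] : exists2 r : R, 0 < r & ball w r `<=` ~` K.
  have oKC : open (~` K) by exact/closed_openC/closed_closure.
  exact/nbhs_ballP/open_nbhs_nbhs.
(* The final chain from [w] through [s t m] and [s t z] to [s k] costs [3 * e], [2 * e] and [e]. *)
pose e := r / 6; have e0 : 0 < e by rewrite /e; lra.
have [m [W [[m_compact m_min] oW W0 shadow]]] :=
  not_sensitive_shadowing aopen mdense nsens e0.
have oB := metric_ball_open R X w.
have [s1 [_ [[z1 Wz1 <-]]]] : exists s, (Phi s @` W) `&` ball w e !=set0.
  by apply: trans => //; exists w; exact: ballxx.
rewrite ballEmdist /= => wz1.
have orbit_near_w :
    closure (sys_orbit Phi m) `&` ball w (3 * e) !=set0.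
  exists (Phi s1 m); split; first exact: orbit_closure_action.
  rewrite ballEmdist /=.
  have := metric_triangle w (Phi s1 z1) (Phi s1 m).
  by have := shadow z1 s1 Wz1; rewrite (metric_sym (Phi s1 m)); lra.
have [F syndetic] :=
  compact_minimal_set_syndetic m_compact m_min (oB _) orbit_near_w.
have [z [t [Wz near_k]]] := transitive_near_action k F trans oW W0 e0.
have [|s sF] := syndetic (Phi t m); first exact: orbit_closure_action.
rewrite ballEmdist /= => w_stm.
apply: (wrK (Phi s k)); last first.
  by case: pmin => _ /minimal_set_action; apply.
rewrite ballEmdist /=.
have := near_k s sF; have := shadow z (s * t)%g Wz; rewrite -!actionM.
rewrite (metric_sym (Phi s k)).
have := metric_triangle w (Phi s (Phi t m)) (Phi s (Phi t z)).
have := metric_triangle w (Phi s (Phi t z)) (Phi s k).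
have re : r = 6 * e by rewrite /e; lra.
by move: w_stm; rewrite re; lra.
Qed.
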